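(* For each integer $k\ge 3$, there are infinitely many connected unweighted graphs (respectively, planar graphs, trees) with maximum degree $k$ admitting pair state transfer at time $\frac{\pi}{2}$.
   Context: For a graph $G$ with adjacency matrix $A(G)$ and transition matrix $U_G(t)=\exp(itA(G))$, there is perfect state transfer (PST) between unit vectors $\mathbf u,\mathbf v$ at time $\tau$ if $U_G(\tau)\mathbf u=\gamma\mathbf v$ for some $\gamma\in\mathbb C$. A pair state is a vector $\frac1{\sqrt2}(\mathbf e_a-\mathbf e_b)$ with $a\ne b$ vertices ($\mathbf e_a$ the standard basis vector). Pair state transfer at $\tau$ means PST at $\tau$ between two pair states that are not scalar multiples of each other. Unweighted means all edge weights equal $1$. *)

(* Defs.v *)
From HB Require Import structures.
From mathcomp Require Import all_boot all_order all_algebra complex.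
From mathcomp Require Import all_classical all_reals all_analysis.

Set Implicit Arguments.
Unset Strict Implicit.
Unset Printing Implicit Defensive.

Import Order.TTheory GRing.Theory Num.Theory numFieldNormedType.Exports.

Local Open Scope classical_set_scope.
Local Open Scope ring_scope.

(* Finite simple (hence loopless and unweighted) graphs. *)
Record sgraph := SGraph {
  order : nat;
  adj : rel 'I_order;
  adj_sym : symmetric adj;
  adj_irr : irreflexive adj
}.

Definition graph_iso (G H : sgraph) : Prop :=
  exists2 f : 'I_(order G) -> 'I_(order H),
    bijective f & forall x y, adj (f x) (f y) = adj x y.

(* Counted up to isomorphism: for labelled graphs, infinitude could be
   obtained by relabelling alone. *)
Definition infinitely_many_graphs (P : sgraph -> Prop) : Prop :=
  exists2 G : nat -> sgraph,
    (forall i, P (G i)) & (forall i j, graph_iso (G i) (G j) -> i = j).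

Definition max_degree (G : sgraph) : nat :=
  \max_(v < order G) #|[set w | adj v w]%SET|.

Definition connected_graph (G : sgraph) : Prop :=
  (0 < order G)%N /\ forall x y : 'I_(order G), connect (@adj G) x y.

(* [ucycle] also accepts the sequences [::] and [:: x; y] with x, y adjacent;
   a graph-theoretic cycle has at least three vertices. *)
Definition acyclic_graph (G : sgraph) : Prop :=
  forall c : seq 'I_(order G), ucycle (@adj G) c -> (size c < 3)%N.

Definition tree (G : sgraph) : Prop := connected_graph G /\ acyclic_graph G.

(* A drawing without crossings.  The curve of the edge {u, v} is [arc u v]
   with u < v; the values of [arc] at all other pairs are irrelevant. *)
Record plane_drawing (R : realType) (G : sgraph)
    (pt : 'I_(order G) -> R * R)
    (arc : 'I_(order G) -> 'I_(order G) -> R -> R * R) : Prop := {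
  pt_inj : injective pt;
  arc_cont : forall u v : 'I_(order G), (u < v)%N -> adj u v ->
    {within `[0, 1], continuous (arc u v)};
  arc_inj : forall u v : 'I_(order G), (u < v)%N -> adj u v ->
    {in `[0, 1]%R &, injective (arc u v)};
  arc_ends : forall u v : 'I_(order G), (u < v)%N -> adj u v ->
    arc u v 0 = pt u /\ arc u v 1 = pt v;
  arc_avoids_pt : forall u v : 'I_(order G), (u < v)%N -> adj u v ->
    forall w t, 0 < t < 1 -> arc u v t <> pt w;
  arc_disjoint : forall u v x y : 'I_(order G), (u < v)%N -> adj u v ->
    (x < y)%N -> adj x y -> (u, v) <> (x, y) ->
    forall s t, 0 < s < 1 -> 0 < t < 1 -> arc u v s <> arc x y t
}.

Definition planar (R : realType) (G : sgraph) : Prop :=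
  exists pt arc, @plane_drawing R G pt arc.

Definition adjmx (R : realType) (G : sgraph) : 'M[R[i]]_(order G) :=
  \matrix_(x, y) (adj x y)%:R.

Definition expmx (R : realType) (n : nat) (M : 'M[R[i]]_n) : 'M[R[i]]_n :=
  lim (series (fun m => (m`!)%:R^-1 *: (M ^+ m : 'M[R[i]]_n)) @ \oo).

Definition transition (R : realType) (G : sgraph) (t : R) :
    'M[R[i]]_(order G) :=
  expmx (('i * t%:C%C) *: adjmx R G).

Definition unit_vector (R : realType) (n : nat) (u : 'cV[R[i]]_n) : Prop :=
  \sum_x `|u x ord0| ^+ 2 = 1.

Definition pst (R : realType) (G : sgraph) (u v : 'cV[R[i]]_(order G))
    (t : R) : Prop :=
  [/\ unit_vector u, unit_vector v &
      exists gamma : R[i], transition G t *m u = gamma *: v].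

Definition pair_vector (R : realType) (n : nat) (a b : 'I_n) : 'cV[R[i]]_n :=
  (sqrtC 2)^-1 *: (delta_mx a ord0 - delta_mx b ord0).

Definition pair_state (R : realType) (n : nat) (u : 'cV[R[i]]_n) : Prop :=
  exists a b : 'I_n, a <> b /\ u = pair_vector R a b.

Definition scalar_multiples (R : realType) (n : nat) (u v : 'cV[R[i]]_n) :
    Prop :=
  exists c : R[i], u = c *: v \/ v = c *: u.

Definition pair_state_transfer (R : realType) (G : sgraph) (t : R) : Prop :=
  exists u v : 'cV[R[i]]_(order G),
    [/\ pair_state u, pair_state v, ~ scalar_multiples u v & pst u v t].

(* Main.v *)
(* A spider is a tree formed by legs glued at a centre.  If two legs have length
   two, with vertices a, b and a', b' in this order from the centre, then the
   centre cancels out and the adjacency matrix A exchanges e_a - e_a' and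
   e_b - e_b'.  Hence exp(itA) acts on their span as exp(it X) for X the swap,
   and exp(i pi/2 X) = i X.  Lengthening a third leg and adding legs of length
   one gives infinitely many trees of any maximum degree k >= 3, which are planar. *)
Require Import Defs.
From mathcomp Require Import all_boot all_order all_algebra complex.
From mathcomp Require Import all_classical all_reals all_analysis.
From mathcomp Require Import zify ring lra.
Import Order.TTheory GRing.Theory Num.Theory numFieldNormedType.Exports.
Local Open Scope classical_set_scope.
Local Open Scope ring_scope.

(** * Entrywise bounds and limits of matrices *)

Lemma ler_norm_mx_entry (K : numFieldType) (m n : nat) (M : 'M[K]_(m, n)) i j :
  `|M i j| <= `|M|.
Proof.
rewrite [leRHS]mx_normE -[leLHS]nngE num_le.
exact: (le_bigmax _ (fun k => `|M k.1 k.2|%:nng) (i, j)).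
Qed.

(** The norm is the maximum over the entries, and an entry of a product is a sum of [n] products:
    each multiplication costs a factor [n%:R]. *)
Lemma ler_norm_mx_pow (K : numFieldType) (n : nat) (M : 'M[K]_n) (m : nat) i j :
  `|(M ^+ m) i j| <= (n%:R * `|M|) ^+ m.
Proof.
elim: m i j => [|m IH] i j.
  by rewrite !expr0 mxE; case: eqP; rewrite ?normr1 ?normr0.
rewrite !exprS -mulmxE mxE; apply: le_trans (ler_norm_sum _ _ _) _.
have -> : n%:R * `|M| * (n%:R * `|M|) ^+ m = \sum_(k < n) `|M| * (n%:R * `|M|) ^+ m.
  by rewrite sumr_const card_ord -[RHS]mulr_natl mulrA.
by apply: ler_sum => k _; rewrite normrM ler_pM ?ler_norm_mx_entry.
Qed.

Section MatrixLimits.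
Variables (K : numFieldType) (T : Type) (F : set_system T).
Context {FF : Filter F}.

(** There are finitely many entries, so the entrywise conditions can be intersected. *)
Lemma cvg_mx (m n : nat) (f : T -> 'M[K]_(m, n)) (L : 'M[K]_(m, n)) :
  (forall i j, f x i j @[x --> F] --> L i j) -> f x @[x --> F] --> L.
Proof.
move=> fL A [P LP PA]; rewrite /= nbhs_filterE.
apply: (filterS (P := fun x => forall i j, P i j (f x i j))).
  by move=> x; exact: PA.
by apply: filter_forall => i; apply: filter_forall => j; exact: fL.
Qed.

Lemma cvg_mx_entry (m n : nat) (f : T -> 'M[K]_(m, n)) (L : 'M[K]_(m, n)) i j :
  f x @[x --> F] --> L -> f x i j @[x --> F] --> L i j.
Proof.
move=> fL; apply/cvgrPdist_lt => e e0; move/cvgrPdist_lt: fL => /(_ e e0).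
apply: filterS => x; apply: le_lt_trans.
by have := ler_norm_mx_entry _ _ _ (L - f x) i j; rewrite !mxE.
Qed.

Lemma cvg_mulmxr (m n p : nat) (f : T -> 'M[K]_(m, n)) (L : 'M[K]_(m, n))
    (u : 'M[K]_(n, p)) :
  f x @[x --> F] --> L -> f x *m u @[x --> F] --> L *m u.
Proof.
move=> fL; apply: cvg_mx => i j.
under eq_cvg do rewrite mxE.
rewrite mxE; apply: cvg_big => [|k _]; first by move=> [a b]; exact: add_continuous.
by apply: cvgMr_tmp; exact: cvg_mx_entry.
Qed.

Lemma cvg_lincomb (m n : nat) (x y : T -> K) (x0 y0 : K) (a b : 'M[K]_(m, n)) :
  x t @[t --> F] --> x0 -> y t @[t --> F] --> y0 ->
  x t *: a + y t *: b @[t --> F] --> x0 *: a + y0 *: b.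
Proof.
move=> xx0 yy0; apply: cvg_mx => i j; under eq_cvg do rewrite !mxE.
by rewrite !mxE; apply: cvgD; exact: cvgMr_tmp.
Qed.

End MatrixLimits.

(** * Complex series and convergence of the matrix exponential *)

Section ComplexLimits.
Variable R : realType.
Let C : numFieldType := R[i].

Lemma normc_real (x : R) : `|x%:C%C : C| = `|x|%:C%C.
Proof. by rewrite normc_def /= expr0n addr0 sqrtr_sqr. Qed.

(** Multiplication by the imaginary unit keeps the modulus and turns the imaginary part, up to sign,
    into the real part. *)
Lemma normc_ge_Im (x : R[i]) : `|complex.Im x|%:C%C <= `|x|.
Proof.
have -> : `|x| = `|x * 'i%C| :> R[i].
  by rewrite normrM [X in _ * X]normc_def /= expr0n expr1n add0r sqrtr1 mulr1.
by rewrite -[`|complex.Im x|]normrN -ReiNIm; exact: normc_ge_Re.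
Qed.

Lemma cvg_real_complex (x : nat -> R) (a : R) :
  x n @[n --> \oo] --> a -> ((x n)%:C%C : C) @[n --> \oo] --> (a%:C%C : C).
Proof.
move=> xa; apply/cvgrPdist_lt => e e0.
(* Positivity in [R[i]] forces the imaginary part to vanish. *)
have [r r0 er] : exists2 r : R, 0 < r & e = r%:C%C.
  by case: e e0 => r s; rewrite ltcE /= => /andP[/eqP -> r0]; exists r.
move/cvgrPdist_lt: xa => /(_ _ r0); apply: filterS => n xn.
by rewrite -rmorphB er normc_real ltcR.
Qed.

(** The real and imaginary parts converge absolutely by comparison with [b], and their limits
    recombine. *)
Lemma is_cvg_complex_series (z : nat -> C) (b : nat -> R) :
  (forall n, `|z n| <= (b n)%:C%C) -> cvgn (series b) -> cvgn (series z).
Proof.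
move=> zb cb.
have cvg_part (f : C -> R) : (forall x, `|f x|%:C%C <= `|x|) -> cvgn (series (f \o z)).
  move=> fle; apply: normed_cvg; apply: series_le_cvg cb => n /=.
  - exact: normr_ge0.
  - by rewrite -lecR; apply: le_trans (zb n); exact: normr_ge0.
  - by rewrite -lecR; apply: le_trans (zb n); exact: fle.
have cRe := cvg_part _ (@normc_ge_Re R); have cIm := cvg_part _ normc_ge_Im.
pose reS := series (@complex.Re R \o z); pose imS := series (@complex.Im R \o z).
apply/cvg_ex; exists ((limn reS)%:C%C + 'i%C * (limn imS)%:C%C).
have -> : series z = fun N => (reS N)%:C%C + 'i%C * (imS N)%:C%C :> C.
  apply/funext => N; rewrite /reS /imS /series /= !rmorph_sum mulr_sumr -big_split /=.
  by apply: eq_bigr => k _; exact: complexE.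
by apply: cvgD; [|apply: cvgM; [exact: cvg_cst|]]; exact: cvg_real_complex.
Qed.

(** [expmx] is a [lim], informative only once the series converges; each entry is dominated by the
    real exponential series at [n] times the norm of [M]. *)
Lemma expmx_cvg (n : nat) (M : 'M[C]_n) :
  (series (fun m => (m`!)%:R^-1 *: (M ^+ m : 'M[C]_n)) @ \oo) --> (expmx M : 'M[C]_n).
Proof.
have cvg_entry i j : cvgn (series (fun m => (m`!)%:R^-1 * (M ^+ m : 'M[C]_n) i j)).
  pose r := complex.Re (n%:R * `|M|).
  have rE : r%:C%C = n%:R * `|M| :> C.
    by rewrite RRe_real // realM ?realn // normr_real.
  apply: (@is_cvg_complex_series _ (exp_coeff r)) (is_cvg_series_exp_coeff r).
  move=> m; rewrite /exp_coeff /= rmorphM rmorphXn fmorphV rmorph_nat /= rE.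
  rewrite normrM mulrC normfV normr_nat ler_wpM2r ?invr_ge0 ?ler0n //.
  exact: ler_norm_mx_pow.
suff : cvgn (series (fun m => (m`!)%:R^-1 *: (M ^+ m : 'M[C]_n))) by [].
apply/cvg_ex.
exists (\matrix_(i, j) limn (series (fun m => (m`!)%:R^-1 * (M ^+ m : 'M[C]_n) i j))).
apply: cvg_mx => i j; rewrite mxE.
suff -> : (fun N => series (fun m => (m`!)%:R^-1 *: (M ^+ m : 'M[C]_n)) N i j) =
  series (fun m => (m`!)%:R^-1 * (M ^+ m : 'M[C]_n) i j) by exact: cvg_entry.
by apply/funext => N; rewrite /series /= summxE; apply: eq_bigr => m _; rewrite mxE.
Qed.

End ComplexLimits.

(** * The exponential on two vectors exchanged by a matrix *)

Section Swap.
Variable R : realType.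
Let C : numFieldType := R[i].
Variables (n : nat) (A : 'M[C]_n) (a b : 'cV[C]_n) (t : R) (ii : C).
Hypotheses (ii2 : ii ^+ 2 = -1) (Aa : A *m a = b) (Ab : A *m b = a).
Let M : 'M[C]_n := (ii * t%:C%C) *: A.

Lemma swap_pow m : (M ^+ m) *m a = (ii * t%:C%C) ^+ m *: (if odd m then b else a).
Proof.
elim: m => [|m IH]; first by rewrite !expr0 mul1mx scale1r.
rewrite exprS -mulmxE -mulmxA IH -scalemxAr -scalemxAl scalerA -exprSr /=.
by case: (odd m); rewrite /= ?Aa ?Ab.
Qed.

(** Even powers of [M] keep [a] and odd ones give [b]; the parity factors in [cos_coeff] and
    [sin_coeff] make the identity hold term by term. *)
Lemma swap_series N :
  series (fun m => (m`!)%:R^-1 *: (M ^+ m : 'M[C]_n)) N *m a =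
  (series (cos_coeff t) N)%:C%C *: a + (ii * (series (sin_coeff t) N)%:C%C) *: b.
Proof.
rewrite /series /= !rmorph_sum mulr_sumr !scaler_suml mulmx_suml -big_split /=.
apply: eq_bigr => m _; rewrite -scalemxAl swap_pow scalerA.
rewrite /cos_coeff /sin_coeff /=.
rewrite -?exprnP !(rmorphM, fmorphV, rmorphXn, rmorph_nat, rmorphN, rmorph1) /=.
(* Splitting off the parity of [m] turns [ii ^+ m] into a sign times [1] or [ii]. *)
rewrite exprMn -[m in ii ^+ m]odd_double_half exprD -mul2n exprM ii2.
case: (boolP (odd m)) => mo /=.
  rewrite !mul0r scale0r add0r; congr (_ *: _).
  have -> : m.-1./2 = m./2 by lia.
  by rewrite expr1; ring.
by rewrite !mul0r mulr0 scale0r addr0; congr (_ *: _); rewrite expr0; ring.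
Qed.

Lemma expmx_swap :
  expmx M *m a = (cos t)%:C%C *: a + (ii * (sin t)%:C%C) *: b.
Proof.
have L : series (fun m => (m`!)%:R^-1 *: (M ^+ m : 'M[C]_n)) N *m a @[N --> \oo] -->
    (expmx M *m a : 'cV[C]_n).
  by apply: cvg_mulmxr; exact: expmx_cvg.
have cc : (series (cos_coeff t) N)%:C%C @[N --> \oo] --> ((cos t)%:C%C : C).
  by apply: cvg_real_complex; rewrite unlock; exact: is_cvg_series_cos_coeff.
have cs : (series (sin_coeff t) N)%:C%C @[N --> \oo] --> ((sin t)%:C%C : C).
  by apply: cvg_real_complex; rewrite unlock; exact: is_cvg_series_sin_coeff.
have ci : ii * (series (sin_coeff t) N)%:C%C @[N --> \oo] --> ii * (sin t)%:C%C.
  by apply: cvgM; [exact: cvg_cst|exact: cs].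
have L2 : series (fun m => (m`!)%:R^-1 *: (M ^+ m : 'M[C]_n)) N *m a @[N --> \oo] -->
    ((cos t)%:C%C *: a + (ii * (sin t)%:C%C) *: b : 'cV[C]_n).
  rewrite (funext swap_series).
  by apply: cvg_lincomb; [exact: cc|exact: ci].
exact: (cvg_unique (@norm_hausdorff _ _) L L2).
Qed.

End Swap.

(** * Pair states and transfer between two exchanged pairs *)

Section PairStates.
Variable R : realType.

Lemma pair_vectorE n (a b x : 'I_n) y :
  pair_vector R a b x y = (sqrtC 2)^-1 * ((x == a)%:R - (x == b)%:R).
Proof. by rewrite !mxE ord1 !eqxx !andbT. Qed.

Lemma unit_pair_vector n (a b : 'I_n) : a != b -> unit_vector (pair_vector R a b).
Proof.
move=> ab; rewrite /unit_vector.
transitivity (\sum_x (2^-1 * ((x == a)%:R + (x == b)%:R)) : R[i]).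
  apply: eq_bigr => x _; rewrite pair_vectorE -normrX exprMn exprVn sqrtCK normrM.
  rewrite ger0_norm ?invr_ge0 //; congr (_ * _).
  have [->|_] := eqVneq x a; last first.
    by case: eqVneq => _; rewrite sub0r add0r sqrrN ?expr1n ?expr0n ?normr1 ?normr0.
  by rewrite (negPf ab) subr0 addr0 expr1n normr1.
have sum1 (c : 'I_n) : \sum_x (x == c)%:R = 1 :> R[i].
  by rewrite (bigD1 c) //= eqxx big1 ?addr0 // => x /negPf ->.
by rewrite -mulr_sumr big_split /= !sum1 mulVf ?pnatr_eq0.
Qed.

(** Entry [a] refutes a multiple of the second vector, which vanishes there; entry [b] refutes a
    multiple of the first. *)
Lemma pair_state_not_scalar n (a a' b b' : 'I_n) :
  a != a' -> b != b' -> a != b -> a != b' -> b != a' ->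
  ~ scalar_multiples (pair_vector R a a') (pair_vector R b b').
Proof.
have s0 : (sqrtC 2)^-1 != 0 :> R[i] by rewrite invr_eq0 sqrtC_eq0 pnatr_eq0.
move=> aa' bb' ab ab' ba' [c [] /matrixP e].
  have := e a ord0; rewrite [X in _ = X]mxE !pair_vectorE.
  rewrite eqxx (negPf aa') (negPf ab) (negPf ab').
  by rewrite !subr0 mulr1 !mulr0 => /eqP; rewrite (negPf s0).
have := e b ord0; rewrite [X in _ = X]mxE !pair_vectorE.
rewrite eqxx (negPf bb') eq_sym (negPf ab) (negPf ba').
by rewrite !subr0 mulr1 !mulr0 => /eqP; rewrite (negPf s0).
Qed.

Lemma adjmx_pair_vector (G : sgraph) (a a' b b' : 'I_(Defs.order G)) :
  (forall x, (adj x a)%:R - (adj x a')%:R = (x == b)%:R - (x == b')%:R :> R[i]) ->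
  adjmx R G *m pair_vector R a a' = pair_vector R b b'.
Proof.
move=> E; have col c x : (adjmx R G *m delta_mx c (ord0 : 'I_1)) x ord0 = (adj x c)%:R.
  by rewrite -colE !mxE.
apply/matrixP => x y; rewrite ord1 pair_vectorE -E -scalemxAr mulmxBr !mxE.
by rewrite -!col !mxE.
Qed.

(** At [pi / 2] the cosine vanishes and the sine is 1, so the first pair vector goes to ['i] times
    the second. *)
Lemma pair_state_transfer_swap (G : sgraph) (a a' b b' : 'I_(Defs.order G)) :
  a != a' -> b != b' -> a != b -> a != b' -> b != a' ->
  (forall x, (adj x a)%:R - (adj x a')%:R = (x == b)%:R - (x == b')%:R :> R[i]) ->
  (forall x, (adj x b)%:R - (adj x b')%:R = (x == a)%:R - (x == a')%:R :> R[i]) ->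
  pair_state_transfer G (pi / 2 : R).
Proof.
move=> aa' bb' ab ab' ba' Ea Eb.
exists (pair_vector R a a'), (pair_vector R b b'); split.
- by exists a, a'; split=> //; exact/eqP.
- by exists b, b'; split=> //; exact/eqP.
- exact: pair_state_not_scalar.
split; [exact: unit_pair_vector|exact: unit_pair_vector|exists 'i].
have := @expmx_swap R _ _ _ _ (pi / 2) 'i (sqrCi _)
  (adjmx_pair_vector _ _ _ _ _ Ea) (adjmx_pair_vector _ _ _ _ _ Eb).
by rewrite cos_pihalf sin_pihalf scale0r add0r mulr1.
Qed.

End PairStates.

(** * Trees given by a parent function *)

Section ParentGraph.
Variables (p : nat -> nat) (p_lt : forall v, (0 < v)%N -> (p v < v)%N) (n : nat).

(** The root is [0]; the guards discard the meaningless value [p 0]. *)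
Definition parent_adj : rel 'I_n.+1 := fun x y =>
  ((0 < y)%N && (p y == x)) || ((0 < x)%N && (p x == y)).

Lemma parent_adj_sym : symmetric parent_adj.
Proof. by move=> x y; rewrite /parent_adj orbC. Qed.

Lemma parent_adj_irr : irreflexive parent_adj.
Proof.
move=> x; rewrite /parent_adj orbb; apply/negP => /andP[x0 /eqP px].
by have := p_lt _ x0; rewrite px ltnn.
Qed.

Definition parent_graph : sgraph :=
  @SGraph n.+1 parent_adj parent_adj_sym parent_adj_irr.

Lemma parent_adj_lt (x y : 'I_n.+1) : (x < y)%N -> parent_adj x y -> p y = x.
Proof.
move=> xy /orP[/andP[_ /eqP//]|/andP[x0 /eqP px]].
by have := p_lt _ x0; rewrite px ltnNge (ltnW xy).
Qed.

(** Passing to the parent lowers the label, so every vertex reaches the root. *)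
Lemma parent_graph_connected : connected_graph parent_graph.
Proof.
split=> //= x y.
have to0 : forall m (z : 'I_n.+1), (z <= m)%N -> connect parent_adj z ord0.
  elim=> [|m IH] z zm; first by rewrite (_ : z = ord0) //; apply/val_inj => /=; lia.
  have [z0|z0] := posnP z; first by rewrite (_ : z = ord0) //; exact/val_inj.
  have pz := p_lt _ z0.
  have pzn : (p z < n.+1)%N by rewrite (ltn_trans pz).
  apply: (@connect_trans _ _ (Ordinal pzn)); last by apply: IH => /=; lia.
  by apply: connect1; rewrite /parent_adj z0 /= eqxx orbT.
apply: (@connect_trans _ _ ord0); first exact: to0 (leqnn _).
by rewrite (sym_connect_sym parent_adj_sym); exact: to0 (leqnn _).
Qed.

(* The largest vertex of a cycle has both its neighbours on the cycle below it,
   and both are its parent. *)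
Lemma parent_graph_acyclic : acyclic_graph parent_graph.
Proof.
move=> c /andP[cyc unc]; rewrite ltnNge; apply/negP => sz.
have c0 : nth ord0 c 0 \in c by apply: mem_nth; exact: leq_trans sz.
pose m := [arg max_(i > nth ord0 c 0 in c) (i : nat)].
have [mc mmax] : m \in c /\ forall y, y \in c -> (y <= m)%N.
  by rewrite /m; case: arg_maxnP => // i ic imax; split.
(* Once the cycle starts at [m], the neighbours of [m] on it are the second and the last entries. *)
have [j s cE] := rot_to mc.
have {unc}unc : uniq (m :: s) by rewrite -cE rot_uniq.
have {cyc}cyc : cycle parent_adj (m :: s) by rewrite -cE rot_cycle.
have {mmax}mmax y : y \in m :: s -> (y <= m)%N by rewrite -cE mem_rot; exact: mmax.
have {}sz : (2 < size (m :: s))%N by rewrite -cE size_rot.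
case: s cE unc cyc mmax sz => [//|a s] _ /= /and3P[mas ains uns].
rewrite rcons_path => /andP[ma /andP[_ lm]] mmax sz.
have below (y : 'I_n.+1) : y \in a :: s -> parent_adj y m -> p m = y.
  move=> ys; apply: parent_adj_lt; rewrite ltn_neqAle mmax ?andbT.
    2: by rewrite inE ys orbT.
  by apply: contra mas => /eqP/val_inj <-.
have pa : p m = a by apply: below; rewrite ?mem_head // parent_adj_sym.
have pl : p m = last a s by apply: below => //; exact: mem_last.
have al : a = last a s by apply/val_inj; exact: etrans (esym pa) pl.
(* The second entry equals the last, so it is repeated unless the cycle has only two vertices. *)
case: s al ains {mas uns lm mmax pl below} sz => [//|b s] /= al + _.
by rewrite {1}al mem_last.
Qed.

Lemma parent_graph_tree : tree parent_graph.
Proof. by split; [exact: parent_graph_connected|exact: parent_graph_acyclic]. Qed.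

End ParentGraph.

(** Uniqueness of the integral part; in the drawing it recovers a depth from an abscissa. *)
Lemma natr_frac_inj (R : realDomainType) (m n : nat) (s t : R) :
  0 <= s < 1 -> 0 <= t < 1 ->
  m%:R + s = n%:R + t -> m = n.
Proof.
have aux (a b : nat) (x y : R) : 0 <= x -> y < 1 -> a%:R + x = b%:R + y -> (a <= b)%N.
  move=> x0 y1 e; rewrite -ltnS -(ltr_nat R) -[b.+1]addn1 natrD; lra.
move=> /andP[s0 s1] /andP[t0 t1] e; apply/eqP; rewrite eqn_leq.
by rewrite (aux _ _ _ _ s0 t1 e) (aux _ _ _ _ t0 s1 (esym e)).
Qed.

(** * Spiders, their coordinates and their maximum degree *)

Section Spider.
Variable k : nat.
Hypothesis k3 : (3 <= k)%N.

(* The centre is 0 and its neighbours are 1, ..., k; the legs starting at 1 and 2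
   end at k + 1 and k + 2, the one starting at 3 continues with k + 3, k + 4, ...,
   and the others consist of a single vertex. *)
Definition spider_parent (v : nat) : nat :=
  if (v <= k)%N then 0%N else if (v <= k + 3)%N then (v - k)%N else v.-1.

Lemma spider_parent_lt v : (0 < v)%N -> (spider_parent v < v)%N.
Proof. by rewrite /spider_parent; do 2?case: ifP; lia. Qed.

(** [n] counts the vertices of leg 3 beyond depth two. *)
Definition spider (n : nat) : sgraph :=
  parent_graph spider_parent spider_parent_lt (k + n + 3).

Lemma spider_tree n : tree (spider n).
Proof. exact: parent_graph_tree. Qed.

Lemma spider_iso_inj m n : graph_iso (spider m) (spider n) -> m = n.
Proof.
by move=> [f /bij_eq_card + _]; rewrite !card_ord => /eqP; rewrite /= eqSS; lia.
Qed.

Definition spider_leg (v : nat) : nat :=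
  if (v <= k)%N then v else if (v <= k + 3)%N then (v - k)%N else 3.

Definition spider_depth (v : nat) : nat :=
  if v == 0%N then 0%N else if (v <= k)%N then 1%N else
  if (v <= k + 3)%N then 2 else (v - k.+1)%N.

(** The only candidate for a child of a vertex off the centre; at a leaf the value is junk. *)
Definition spider_child (v : nat) : nat := if (v <= 3)%N then (v + k)%N else v.+1.

Lemma spider_parent_eq0 v : (0 < v)%N -> spider_parent v = 0%N -> (v.-1 < k)%N.
Proof. by rewrite /spider_parent; do 2?case: ifP; lia. Qed.

Lemma spider_parent_eq_pos v w : (0 < v)%N -> spider_parent w = v -> w = spider_child v.
Proof. by rewrite /spider_child /spider_parent; do 3?case: ifP; lia. Qed.

(** At depth zero both vertices are the centre; otherwise the depth cancels from the product, and
    depth and leg fix the vertex. *)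
Lemma spider_coord_inj u v :
  spider_depth u = spider_depth v ->
  (spider_depth u * spider_leg u = spider_depth v * spider_leg v)%N -> u = v.
Proof.
rewrite /spider_depth /spider_leg.
by (do 6?case: ifP); move=> *; subst; try nia.
Qed.

Lemma spider_depth_parent v :
  (0 < v)%N -> spider_depth v = (spider_depth (spider_parent v)).+1.
Proof.
rewrite /spider_depth /spider_parent.
case: (leqP v k) => ? /=; [|case: (leqP v (k + 3)) => ?]; repeat case: ifP; lia.
Qed.

(** The leg changes only when the parent is the centre, and there the factor is zero. *)
Lemma spider_leg_parent v : (0 < v)%N ->
  (spider_depth (spider_parent v) * spider_leg (spider_parent v) =
   spider_depth (spider_parent v) * spider_leg v)%N.
Proof.
rewrite /spider_depth /spider_leg /spider_parent.
case: (leqP v k) => ? /=; [|case: (leqP v (k + 3)) => ?];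
  repeat case: ifP; move=> *; nia.
Qed.

(** The centre has degree [k]; any other vertex has at most a parent and one child, and two is below
    [k]. *)
Lemma spider_max_degree n : max_degree (spider n) = k.
Proof.
have degree0 (v : 'I_(Defs.order (spider n))) :
      v = 0%N :> nat -> #|[set w | adj v w]%SET| = k.
  move=> v0; have lt (i : 'I_k) : (i.+1 < (k + n + 3).+1)%N by have := ltn_ord i; lia.
  rewrite -[RHS]card_ord -(card_imset _ (f := fun i : 'I_k => Ordinal (lt i))).
    2: by move=> i j [] /val_inj.
  apply: eq_card => w; rewrite inE /= /parent_adj v0 /= orbF.
  apply/andP/imsetP => [[w0 /eqP pw]|[i _ ->]].
    have wk := spider_parent_eq0 w w0 pw.
    by exists (Ordinal wk) => //; apply/val_inj => /=; rewrite prednK.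
  by rewrite /= /spider_parent ltn_ord.
have degree_pos (v : 'I_(Defs.order (spider n))) :
      (0 < v)%N -> (#|[set w | adj v w]%SET| <= k)%N.
  move=> v0; apply: leq_trans (ltnW k3).
  (* The candidate child may fall outside the vertex set; the default of [inord] is harmless for an
     upper bound. *)
  apply: leq_trans (subset_leq_card
    (B := [set inord (spider_parent v); inord (spider_child v)]%SET) _) _.
    apply/fintype.subsetP => w; rewrite !inE /= /parent_adj v0 /=.
    move=> /orP[/andP[w0 /eqP pw]|/eqP ->]; last by rewrite inord_val eqxx.
    by rewrite -(spider_parent_eq_pos _ _ v0 pw) inord_val eqxx orbT.
  by rewrite cards2 ltnS leq_b1.
apply/eqP; rewrite eqn_leq; apply/andP; split.
  apply/bigmax_leqP => v _; have [v0|] := posnP v; last exact: degree_pos.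
  by rewrite degree0.
rewrite -[leqLHS](@degree0 ord0) //.
exact: (@leq_bigmax _ (fun v => #|[set w | adj v w]%SET|)).
Qed.

(** * A plane drawing of the spider *)

Section Drawing.
Variables (R : realType) (n : nat).

(* Leg j is drawn on the ray through (1, j), with its vertices at the integral
   abscissas; so a point of the drawing off the centre determines its leg (the
   slope) and its edge (the integral part of the abscissa). *)
Definition spider_point (v : nat) : R * R :=
  ((spider_depth v)%:R, (spider_depth v * spider_leg v)%:R).

(** The slope is taken from the outer end [v], since [u] may be the centre, which lies on every
    leg. *)
Definition spider_arc (u v : nat) (t : R) : R * R :=
  ((spider_depth u)%:R + t, ((spider_depth u)%:R + t) * (spider_leg v)%:R).

Lemma spider_planar : planar R (spider n).
Proof.
exists (fun v => spider_point v), (fun u v => spider_arc u v).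
have parentE (u v : 'I_(Defs.order (spider n))) : (u < v)%N -> adj u v ->
    (0 < v)%N /\ spider_parent v = u.
  move=> uv e; split; first exact: leq_ltn_trans uv.
  exact: (@parent_adj_lt _ spider_parent_lt _ _ _ uv e).
split.
- move=> u v [/eqP + /eqP]; rewrite !eqr_nat => /eqP e1 /eqP e2.
  by apply/val_inj/spider_coord_inj.
- move=> u v _ _; apply: continuous_subspaceT => t.
  rewrite /continuous_at /spider_arc.
  apply: (cvg_pair (G := nbhs ((spider_depth u)%:R + t))
    (H := nbhs (((spider_depth u)%:R + t) * (spider_leg v)%:R))).
    by apply: cvgD; [exact: cvg_cst|exact: cvg_id].
  by apply: cvgM; [apply: cvgD; [exact: cvg_cst|exact: cvg_id]|exact: cvg_cst].
- by move=> u v _ _ s t _ _ [+ _] => /addrI.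
- move=> u v uv /parentE - /(_ uv)[v0 pv].
  split; rewrite /spider_arc /spider_point.
    by rewrite addr0 -natrM -pv spider_leg_parent.
  by rewrite (@spider_depth_parent v) // pv natrM -natr1.
(* Vertices have integral abscissas, interior points of arcs do not. *)
- move=> u v _ _ w t /andP[t0 t1] [+ _]; rewrite -[RHS]addr0 => e.
  have /natr_frac_inj := e; rewrite (ltW t0) t1 lexx ltr01 => /(_ isT isT) de.
  by move: e; rewrite de => /addrI te; rewrite te ltxx in t0.
- move=> u v x y uv /parentE - /(_ uv)[v0 pv] xy /parentE - /(_ xy)[y0 py].
  move=> ne s t /andP[s0 s1] /andP[t0 t1] [e1 e2]; apply: ne.
  have /natr_frac_inj := e1; rewrite (ltW t0) t1 (ltW s0) s1 => /(_ isT isT) de.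
  (* The common abscissa is positive, so it cancels and leaves the slopes. *)
  have leg : spider_leg v = spider_leg y.
    apply/eqP; rewrite -(eqr_nat R); apply/eqP; move: e2; rewrite -e1; apply: mulfI.
    by rewrite gt_eqF // ltr_wpDl.
  have vy : v = y.
    have dvy : spider_depth v = spider_depth y.
      by rewrite (@spider_depth_parent v) // (@spider_depth_parent y) // pv py de.
    by apply/val_inj/spider_coord_inj; rewrite ?leg dvy.
  by congr pair => //; apply/val_inj; rewrite /= -pv vy py.
Qed.

End Drawing.

(** Legs 1 and 2 have length two whatever [n] is, because only leg 3 grows. *)
Lemma spider_pair_state_transfer (R : realType) n :
  pair_state_transfer (spider n) (pi / 2 : R).
Proof.
have inner x j : (0 < j < 3)%N ->
    ((0 < j) && (spider_parent j == x) || (0 < x) && (spider_parent x == j))%N =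
    ((x == 0) || (x == k + j))%N.
  by rewrite /spider_parent; repeat case: ifP; lia.
have leaf x j : (0 < j < 3)%N ->
    ((0 < k + j) && (spider_parent (k + j) == x) ||
     (0 < x) && (spider_parent x == k + j))%N =
    (x == j)%N.
  by rewrite /spider_parent; repeat case: ifP; lia.
have lt j : (j < 3)%N -> (j < (k + n + 3).+1)%N /\ (k + j < (k + n + 3).+1)%N by lia.
have [l1 lk1] := lt 1%N isT; have [l2 lk2] := lt 2%N isT.
apply: (@pair_state_transfer_swap R (spider n)
  (Ordinal l1) (Ordinal l2) (Ordinal lk1) (Ordinal lk2)).
- by [].
- by rewrite -val_eqE /= eqn_add2l.
- by rewrite -val_eqE /=; lia.
- by rewrite -val_eqE /=; lia.
- by rewrite -val_eqE /=; lia.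
(* At the centre both adjacencies hold and cancel; elsewhere only the leg ends remain. *)
- move=> x; rewrite /= /parent_adj -!val_eqE !inner //=.
  have [x0|_] //= := eqVneq (nat_of_ord x) 0%N.
  by rewrite !ltn_eqF ?subrr // x0; lia.
- by move=> x; rewrite /= /parent_adj -!val_eqE !leaf.
Qed.

End Spider.

Theorem theorem5p1 (R : realType) (k : nat) (hk : (3 <= k)%N) :
  [/\ infinitely_many_graphs (fun G =>
        [/\ connected_graph G, max_degree G = k &
            pair_state_transfer G (pi / 2 : R)]),
      infinitely_many_graphs (fun G =>
        [/\ connected_graph G, planar R G, max_degree G = k &
            pair_state_transfer G (pi / 2 : R)])
    & infinitely_many_graphs (fun G =>
        [/\ tree G, max_degree G = k &
            pair_state_transfer G (pi / 2 : R)])].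
Proof.
have transfer n := @spider_pair_state_transfer k hk R n.
have degree n := @spider_max_degree k hk n.
have planar_spider n := @spider_planar k hk R n.
have tree_spider n := @spider_tree k hk n.
have connected_spider n : connected_graph (spider k hk n) by case: (tree_spider n).
(* The same spiders serve all three claims, told apart by their orders. *)
by split; exists (spider k hk) => [n|m n /spider_iso_inj //]; split.
Qed.
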